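(* Let $n\ge 3$ and consider the cycle graph on nodes $1,\dots,n$ with arbitrary measurements $\widetilde{R}_{12},\dots,\widetilde{R}_{n-1,n},\widetilde{R}_{n1}\in\mathrm{SO}(3)$. Then the point $R^\ast=(R_1^\ast,\dots,R_n^\ast)$ with $R_1^\ast=I_3$ and $$R_i^\ast=\Big(\prod_{s=1}^{i-1}\widetilde{R}_{s,s+1}\Big)^{\top}E_0^{\,i-1},\qquad i\in\{2,\dots,n\},$$ (product from left to right, i.e. $\widetilde{R}_{12}\cdots\widetilde{R}_{i-1,i}$) is a global minimizer of $f$ over $\mathrm{SO}(3)^n$.
   Context: Cycle-graph rotation averaging setup. Let $n\ge 3$. The cycle graph has nodes $1,\dots,n$ and edges $\{i,i+1\}$ for $i=1,\dots,n-1$ together with $\{n,1\}$; write $i\sim j$ if $\{i,j\}$ is an edge. Each edge carries a measured rotation $\widetilde{R}_{ij}\in\mathrm{SO}(3)$, with the convention $\widetilde{R}_{ji}=\widetilde{R}_{ij}^\top$. Define the symmetric $3n\times 3n$ block matrix $\widetilde{R}$ whose $(i,j)$ $3\times3$ block is $I_3$ if $i=j$, $\widetilde{R}_{ij}$ if $i\sim j$, and $0$ otherwise. For $R=(R_1,\dots,R_n)\in\mathrm{SO}(3)^n$, write $R=[R_1^\top\ \cdots\ R_n^\top]^\top\in\mathbb{R}^{3n\times 3}$ and define $f(R):=-\operatorname{Tr}(R^\top\widetilde{R}R)$; the rotation averaging problem is to minimize $f$ over $\mathrm{SO}(3)^n$. The cycle error is $E:=\widetilde{R}_{12}\widetilde{R}_{23}\cdots\widetilde{R}_{n-1,n}\widetilde{R}_{n1}\in\mathrm{SO}(3)$.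 Write $E=\exp(\gamma[\hat n]_\times)$ with unit axis $\hat n$ and angle $\gamma=\angle(E)\in[-\pi,\pi]$. For $k\in\{0,\dots,n-1\}$, $E_k:=\exp\big((\gamma/n-2k\pi/n)[\hat n]_\times\big)$; in particular $E_0=\exp((\gamma/n)[\hat n]_\times)$. *)

(* Defs.v *)
From HB Require Import structures.
From mathcomp Require Import all_boot all_order all_algebra.
From mathcomp Require Import all_classical all_reals all_analysis.
Set Implicit Arguments. Unset Strict Implicit. Unset Printing Implicit Defensive.
Import Order.TTheory GRing.Theory Num.Theory.
Local Open Scope ring_scope.

Definition SO3 {R : realType} (M : 'M[R]_3) : Prop :=
  M^T *m M = 1%:M /\ \det M = 1.

Definition expm {R : realType} (A : 'M[R]_3) : 'M[R]_3 :=
  \matrix_(i < 3, j < 3) (limn (fun N : nat => \sum_(k < N) ((A ^+ k) i j / (k`!)%:R))).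

Definition crossmat {R : realType} (v : 'rV[R]_3) : 'M[R]_3 :=
  \matrix_(i < 3, j < 3)
    (if (i == 0%N :> nat) && (j == 1%N :> nat) then - v 0 2%:R
     else if (i == 0%N :> nat) && (j == 2%N :> nat) then v 0 1%:R
     else if (i == 1%N :> nat) && (j == 0%N :> nat) then v 0 2%:R
     else if (i == 1%N :> nat) && (j == 2%N :> nat) then - v 0 0
     else if (i == 2%N :> nat) && (j == 0%N :> nat) then - v 0 1%:R
     else if (i == 2%N :> nat) && (j == 1%N :> nat) then v 0 0
     else 0).

(* Cycle graph on nodes 'I_n (node k here is node k+1 of the paper).
   Rm k : 'M_3 is the measurement Rtilde_{k,k+1} on edge {k, k+1 mod n}
   (Rm (n-1) is Rtilde_{n,1}). *)
Definition succ_node {n : nat} (i : 'I_n) : nat := (i.+1 %% n)%N.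

Definition Rtilde_block {R : realType} {n : nat} (Rm : 'I_n -> 'M[R]_3)
  (i j : 'I_n) : 'M[R]_3 :=
  if i == j then 1%:M
  else if (j : nat) == succ_node i then Rm i
  else if (i : nat) == succ_node j then (Rm j)^T
  else 0.

(* f(R) = - Tr(R^T Rtilde R) with R the stacked 3n x 3 matrix, written
   blockwise: - sum_{i,j} Tr(R_i^T Rtilde_{ij} R_j). *)
Definition cost {R : realType} {n : nat} (Rm : 'I_n -> 'M[R]_3)
  (X : 'I_n -> 'M[R]_3) : R :=
  - \sum_(i < n) \sum_(j < n) \tr ((X i)^T *m Rtilde_block Rm i j *m X j).

Definition cycle_error {R : realType} {n : nat} (Rm : 'I_n -> 'M[R]_3)
  : 'M[R]_3 := \prod_(k < n) Rm k.

(* Candidate minimizer: R*_i = (Rm_0 ... Rm_{i-1})^T E0^i  (0-based i),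
   so R*_0 = I. *)
Definition Rstar {R : realType} {n : nat} (Rm : 'I_n -> 'M[R]_3)
  (E0 : 'M[R]_3) (i : 'I_n) : 'M[R]_3 :=
  (\prod_(k < n | (k < i)%N) Rm k)^T *m E0 ^+ i.

(* Main.v *)
Require Import Defs.
From HB Require Import structures.
From mathcomp Require Import all_boot all_order all_algebra.
From mathcomp Require Import all_classical all_reals all_analysis.
From mathcomp Require Import ring lra zify.
Import Order.TTheory GRing.Theory Num.Theory.
Import numFieldNormedType.Exports.
Local Open Scope ring_scope.

(* With [Y_i := Rm_0 ... Rm_(i-1) X_i] and [Y_n := E Y_0], the cost becomes
   [- (3 n + 2 \sum_(i < n) <Y_i, Y_(i+1)>)] for the Frobenius inner product,
   and the candidate becomes [Y_i = E0^i], whose edge terms all equal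
   [\tr E0 = 1 + 2 cos (gamma / n)].  To bound the sum for arbitrary [Y], split
   R^3 into the axis of [E] and its orthogonal plane.  On the axis the sequence
   is periodic and Cauchy-Schwarz suffices.  On the plane, [q_n] is [q_0]
   rotated by [gamma], and one needs the discrete Wirtinger inequality
   [\sum <q_i, q_(i+1)> <= cos (gamma / n) \sum |q_i|^2], valid because
   [|gamma| <= pi]; it is proved by minimizing successively over the points of
   the path, with no use of the orthogonality of the [Y_i] beyond their norms. *)

(** * Rodrigues' closed form of the exponential of a skew matrix *)

Definition rodrigues {R : realType} (K : 'M[R]_3) (t : R) : 'M[R]_3 :=
  1%:M + sin t *: K + (1 - cos t) *: (K *m K).

Section Rodrigues.
Variables (R : realType) (K : 'M[R]_3).
Hypothesis K3 : K *m K *m K = - K.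

Lemma expr_skew_odd m : K ^+ m.*2.+1 = (-1) ^+ m *: K.
Proof.
elim: m => [|m IH]; first by rewrite expr0 scale1r expr1.
rewrite doubleS exprSr exprSr IH -!scalerAl -!mulmxE K3.
by rewrite exprS mulN1r scalerN scaleNr.
Qed.

Lemma expr_skew_even m : K ^+ m.+1.*2 = (-1) ^+ m *: (K *m K).
Proof. by rewrite doubleS exprSr expr_skew_odd -scalerAl. Qed.

(** Up to sign, powers of [K] are [K] in odd degree and [K *m K] in positive even degree, which
    sorts the exponential series into sine and cosine series. In degree 0 this pattern would give
    [- (K *m K)] instead of the identity, hence the last summand. *)
Lemma exp_skew_term (t : R) (k : nat) (i j : 'I_3) :
  ((t *: K) ^+ k) i j / k`!%:R =
  sin_coeff t k * K i j - cos_coeff t k * (K *m K) i j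
  + (k == 0)%N%:R * ((1%:M : 'M[R]_3) i j + (K *m K) i j).
Proof.
rewrite exprZn mxE /sin_coeff /cos_coeff /= -exprnP.
have : k = (odd k + k./2.*2)%N by rewrite odd_double_half.
case: (odd k) (k./2) => -[|m] -> {k}.
- by rewrite expr_skew_odd mxE /=; field.
- rewrite expr_skew_odd mxE /= ?uphalf_double ?doubleK ?odd_double /=; ring.
- by rewrite !expr0 /= fact0; field.
- rewrite expr_skew_even mxE /= ?uphalf_double ?doubleK ?odd_double /= [in RHS]exprS; ring.
Qed.

Lemma expm_rodrigues t : expm (t *: K) = rodrigues K t.
Proof.
apply/matrixP => i j; rewrite /expm /rodrigues !mxE.
rewrite (_ : \sum_(k < 3) K i k * K k j = (K *m K) i j); last by rewrite mxE.
apply/cvg_lim => //.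
have Hs := @is_cvg_series_sin_coeff R t.
have Hc := @is_cvg_series_cos_coeff R t.
(* The factor [0 < N] appears because only the empty partial sum lacks the degree-0 correction. *)
have -> : (fun N : nat => \sum_(k < N) (((t *: K) ^+ k) i j / k`!%:R)) =
  (fun N => series (sin_coeff t) N * K i j - series (cos_coeff t) N * (K *m K) i j
    + (0 < N)%N%:R * ((1%:M : 'M[R]_3) i j + (K *m K) i j)).
  apply/funext => N; under eq_bigr do rewrite exp_skew_term.
  rewrite big_split sumrB /= -!mulr_suml /series /= !big_mkord.
  congr (_ + _ * _).
  case: N => [|N]; first by rewrite big_ord0.
  by rewrite big_ord_recl big1 ?addr0.
have -> : (i == j)%:R + sin t * K i j + (1 - cos t) * (K *m K) i j =
   sin t * K i j - cos t * (K *m K) i j + 1 * ((1%:M : 'M[R]_3) i j + (K *m K) i j).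
  by rewrite [1%:M i j]mxE; ring.
apply: cvgD; last first.
  apply: cvgMl; apply: cvg_near_cst; near=> N.
  by have -> : (0 < N)%N by near: N; exact: nbhs_infty_gt.
apply: cvgB; apply: cvgMl; rewrite unlock //.
Unshelve. all: by end_near. Qed.

Lemma rodriguesD s t : rodrigues K s *m rodrigues K t = rodrigues K (s + t).
Proof.
rewrite /rodrigues sinD cosD !mulmxDl !mulmxDr.
rewrite !mul1mx !mulmx1 -!scalemxAl -!scalemxAr !scalerA !mulmxA K3 !mulNmx !scalerN.
apply/matrixP => i j; rewrite !mxE; set x := \sum_k _; ring.
Qed.

Lemma rodrigues0 : rodrigues K 0 = 1%:M.
Proof. by rewrite /rodrigues sin0 cos0 subrr !scale0r !addr0. Qed.

Lemma rodriguesX t m : rodrigues K t ^+ m = rodrigues K (t *+ m).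
Proof.
elim: m => [|m IH]; first by rewrite expr0 mulr0n rodrigues0.
by rewrite exprS IH -mulmxE rodriguesD mulrS.
Qed.

Hypothesis KT : K^T = - K.

Lemma tr_rodrigues t : (rodrigues K t)^T = rodrigues K (- t).
Proof.
rewrite /rodrigues sinN cosN !linearD /= !linearZ /= tr_scalar_mx trmx_mul KT.
by rewrite mulNmx mulmxN opprK scalerN scaleNr.
Qed.

Lemma SO3_rodrigues t : SO3 (rodrigues K t).
Proof.
split; first by rewrite tr_rodrigues rodriguesD addNr rodrigues0.
(* The rotation is the square of its half-angle rotation [Q], so its determinant equals that of
   [Q^T *m Q], which is 1. *)
have -> : t = t / 2 + t / 2 by field.
rewrite -rodriguesD detM -{1}(det_tr (rodrigues K (t / 2))) -det_mulmx.
by rewrite tr_rodrigues rodriguesD addNr rodrigues0 det1.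
Qed.

End Rodrigues.

(** * Cross-product matrices *)

Lemma tr_crossmat (R : realType) (v : 'rV[R]_3) : (crossmat v)^T = - crossmat v.
Proof.
apply/matrixP => -[[|[|[|//]]] i] [[|[|[|//]]] j]; rewrite !mxE /=; ring.
Qed.

Lemma big_ord3 (V : nmodType) (F : 'I_3 -> V) :
  \sum_(i < 3) F i = F 0 + F 1%:R + F 2%:R.
Proof.
rewrite !big_ord_recl big_ord0 addr0 addrA.
by congr (F _ + F _ + F _); apply/val_inj.
Qed.

Lemma ord3_cases (P : 'I_3 -> Prop) : P 0 -> P 1%:R -> P 2%:R -> forall i, P i.
Proof.
move=> P0 P1 P2 [[|[|[|//]]] i].
- by rewrite (_ : Ordinal i = 0) //; apply/val_inj.
- by rewrite (_ : Ordinal i = 1%:R) //; apply/val_inj.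
- by rewrite (_ : Ordinal i = 2%:R) //; apply/val_inj.
Qed.

Lemma mul_crossmat (R : realType) (v : 'rV[R]_3) : v *m crossmat v = 0.
Proof.
apply/matrixP => i; elim/ord3_cases; rewrite (ord1 i) !mxE big_ord3 !mxE /=; ring.
Qed.

(** This is the double cross product identity; the right-hand side is minus the orthogonal
    projection onto the plane normal to [v]. *)
Lemma crossmat_sq (R : realType) (v : 'rV[R]_3) :
  v 0 0 ^+ 2 + v 0 1%:R ^+ 2 + v 0 2%:R ^+ 2 = 1 ->
  crossmat v *m crossmat v = v^T *m v - 1%:M.
Proof.
move=> v1; apply/matrixP; elim/ord3_cases; elim/ord3_cases;
  rewrite !mxE big_ord3 big_ord1 !mxE /=; first [ring | rewrite -v1; ring].
Qed.

(** * Frobenius inner product and the discrete Wirtinger inequality *)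

Definition mxdot {R : realType} {m p : nat} (A B : 'M[R]_(m, p)) : R :=
  \tr (A^T *m B).

Section Mxdot.
Variables (R : realType) (m p : nat).
Implicit Types A B C : 'M[R]_(m, p).

Lemma mxdotC A B : mxdot A B = mxdot B A.
Proof. by rewrite /mxdot -mxtrace_tr trmx_mul trmxK. Qed.

Lemma mxdotDl A B C : mxdot (A + B) C = mxdot A C + mxdot B C.
Proof. by rewrite /mxdot linearD /= mulmxDl linearD. Qed.

Lemma mxdotZl a A B : mxdot (a *: A) B = a * mxdot A B.
Proof. by rewrite /mxdot linearZ /= -scalemxAl linearZ. Qed.

Lemma mxdotDr A B C : mxdot A (B + C) = mxdot A B + mxdot A C.
Proof. by rewrite mxdotC mxdotDl !(mxdotC A). Qed.

Lemma mxdotZr a A B : mxdot A (a *: B) = a * mxdot A B.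
Proof. by rewrite mxdotC mxdotZl (mxdotC A). Qed.

Lemma mxdot_ge0 A : 0 <= mxdot A A.
Proof.
rewrite /mxdot /mxtrace sumr_ge0 // => i _.
by rewrite mxE sumr_ge0 // => k _; rewrite mxE -expr2 sqr_ge0.
Qed.

Lemma periodic_sum_shift (f : nat -> R) n :
  f n = f 0%N -> \sum_(i < n) f i.+1 = \sum_(i < n) f i.
Proof.
move=> fn; apply: (addrI (f 0%N)).
by rewrite -(big_ord_recl n (fun i => f i)) big_ord_recr /= fn addrC.
Qed.

(** Expanding the square of [q i - q i.+1] bounds each term by the mean of two squared norms, and
    periodicity makes both sums of squared norms equal. *)
Lemma periodic_sum_dot (q : nat -> 'M[R]_(m, p)) n :
  q n = q 0%N ->
  \sum_(i < n) mxdot (q i) (q i.+1) <= \sum_(i < n) mxdot (q i) (q i).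
Proof.
move=> qn.
have shift : \sum_(i < n) mxdot (q i.+1) (q i.+1) = \sum_(i < n) mxdot (q i) (q i).
  by apply: (periodic_sum_shift (fun i => mxdot (q i) (q i))); rewrite qn.
have : \sum_(i < n) 2 * mxdot (q i) (q i.+1) <=
  \sum_(i < n) (mxdot (q i) (q i) + mxdot (q i.+1) (q i.+1)).
  apply: ler_sum => i _; have := mxdot_ge0 (q i + -1 *: q i.+1).
  rewrite !(mxdotDl, mxdotDr, mxdotZl, mxdotZr) (mxdotC (q i.+1) (q i)); lra.
rewrite big_split /= shift -mulr_sumr; lra.
Qed.

(** Defect in the Wirtinger inequality, doubled, with the squared norms shared between the two ends
    of each edge so that it is additive along a path. *)
Definition path_energy (a : R) (q : nat -> 'M[R]_(m, p)) (k : nat) : R :=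
  \sum_(i < k) (cos a * (mxdot (q i) (q i) + mxdot (q i.+1) (q i.+1))
                - 2 * mxdot (q i) (q i.+1)).

(* The left-hand side is the minimum of the right-hand side over the interior
   points [q 1, ..., q (k - 1)]; the inductive step minimizes over one of them
   by completing a square. *)
Lemma path_energy_ge a q k : 0 < a -> (0 < k)%N -> k%:R * a < pi ->
  sin a * (cos (k%:R * a) * (mxdot (q 0%N) (q 0%N) + mxdot (q k) (q k))
           - 2 * mxdot (q 0%N) (q k))
  <= sin (k%:R * a) * path_energy a q k.
Proof.
move=> a0; elim: k => // -[_ _ _|k IH _ kpi].
  by rewrite /path_energy big_ord1 mul1r.
rewrite /path_energy big_ord_recr /= -/(path_energy a q k.+1).
move: IH; set e := path_energy _ _ _; set b := k.+1%:R * a.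
have bE : k.+2%:R * a = b + a by rewrite /b [in LHS]mulrS; ring.
have b0 : 0 < b by rewrite mulr_gt0 // ltr0n.
have bpi : b < pi by move: kpi; rewrite bE; lra.
move=> /(_ isT bpi) IH.
have sb : 0 < sin b by apply: sin_gt0_pi; rewrite b0.
have sa : 0 < sin a by apply: sin_gt0_pi; move: kpi; rewrite bE a0; lra.
have sba : 0 < sin (b + a) by apply: sin_gt0_pi; rewrite -bE kpi andbT bE; lra.
rewrite bE -(ler_pM2l sb).
(* After the induction hypothesis, what remains is quadratic in [q k.+1], with minimizer [(sin a *:
   q 0 + sin b *: q k.+2) / sin (b + a)], the spherical interpolation of its neighbours; this is the
   completed square. *)
have := mxdot_ge0 (sin (b + a) *: q k.+1 + (- sin a *: q 0%N + - sin b *: q k.+2)).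
rewrite !(mxdotDl, mxdotDr, mxdotZl, mxdotZr).
rewrite (mxdotC (q k.+1) (q 0%N)) (mxdotC (q k.+2) (q 0%N)) (mxdotC (q k.+2) (q k.+1)).
move: IH.
move: (mxdot (q 0%N) (q 0%N)) (mxdot (q k.+1) (q k.+1)) => A B.
move: (mxdot (q k.+2) (q k.+2)) (mxdot (q 0%N) (q k.+1)) => C x.
move: (mxdot (q 0%N) (q k.+2)) (mxdot (q k.+1) (q k.+2)) => y z.
move=> /(ler_wpM2l (ltW sba)).
have Ea : sin a = sin (b + a) * cos b - cos (b + a) * sin b.
  by rewrite -sinB; congr sin; ring.
have Eb : sin b = sin (b + a) * cos a - cos (b + a) * sin a.
  by rewrite -sinB; congr sin; ring.
(* Each trigonometric identity is multiplied by the monomial it is needed with, so that the goal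
   becomes linear. *)
have := congr1 (fun u => sin a * A * u) Ea.
have := congr1 (fun u => sin b * C * u) Eb.
have := congr1 (fun u => sin (b + a) * B * u) (sinD b a).
move: (sin (b + a)) (cos (b + a)) => S T /= h1 h2 h3 h4 h5; lra.
Qed.

(* The Dirichlet-type bound of [path_energy_ge] is applied to the first [n - 1]
   edges only, so that the sine by which one divides is positive even when
   [n%:R * a = pi]. *)
Lemma twisted_sum_dot (q : nat -> 'M[R]_(m, p)) (r : 'M[R]_(m, p)) n a :
  (1 < n)%N -> 0 <= a -> n%:R * a <= pi ->
  mxdot r r = mxdot (q 0%N) (q 0%N) -> mxdot r (q 0%N) = 0 ->
  q n = cos (n%:R * a) *: q 0%N + sin (n%:R * a) *: r ->
  \sum_(i < n) mxdot (q i) (q i.+1) <= cos a * \sum_(i < n) mxdot (q i) (q i).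
Proof.
move=> n1; rewrite le_eqVlt => /orP[/eqP <-|a0] npi rr rq qn.
  (* For [a = 0] the sines vanish, but the sequence is then periodic. *)
  rewrite cos0 mul1r; apply: periodic_sum_dot.
  by rewrite qn mulr0 cos0 sin0 scale1r scale0r addr0.
have qnn : mxdot (q n) (q n) = mxdot (q 0%N) (q 0%N).
  rewrite qn !(mxdotDl, mxdotDr, mxdotZl, mxdotZr) (mxdotC (q 0%N) r) rr rq.
  have := congr1 (fun u => mxdot (q 0%N) (q 0%N) * u) (cos2Dsin2 (n%:R * a)).
  move=> /= h; lra.
have shift : \sum_(i < n) mxdot (q i.+1) (q i.+1) = \sum_(i < n) mxdot (q i) (q i).
  exact: (periodic_sum_shift (fun i => mxdot (q i) (q i))).
suff : 0 <= path_energy a q n.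
  rewrite /path_energy sumrB -!mulr_sumr big_split /= shift; lra.
case: n n1 npi qn qnn shift => [|[|k]] // _ kpi qn qnn _.
rewrite /path_energy big_ord_recr /= -/(path_energy a q k.+1).
have bE : k.+2%:R * a = k.+1%:R * a + a by rewrite [in LHS]mulrS; ring.
have bpi : k.+1%:R * a < pi by move: kpi; rewrite bE; lra.
have := path_energy_ge a q k.+1 a0 isT bpi.
have b0 : 0 < k.+1%:R * a by rewrite mulr_gt0 // ltr0n.
have sb : 0 < sin (k.+1%:R * a) by apply: sin_gt0_pi; rewrite b0.
have sab : 0 <= sin (k.+2%:R * a) by apply: sin_ge0_pi; rewrite kpi andbT bE; lra.
rewrite -(pmulr_rge0 _ sb) qnn.
set e := path_energy _ _ _.
(* With [b = k.+1%:R * a], the lower bound left for the energy times [sin b] is [sin (b + a)] times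
   the squared distance from [q k.+1] to the point at angle [b] on the arc from [q 0] towards [r].
   Only [0 <= sin (b + a)] is required here. *)
have := mxdot_ge0 (q k.+1 + (- cos (k.+1%:R * a) *: q 0%N + - sin (k.+1%:R * a) *: r)).
rewrite qn !(mxdotDl, mxdotDr, mxdotZl, mxdotZr) rr.
rewrite (mxdotC (q 0%N) r) (mxdotC (q 0%N) (q k.+1)) (mxdotC r (q k.+1)) rq.
move: sb sab (cos2Dsin2 (k.+1%:R * a)); rewrite bE.
set b := k.+1%:R * a.
move: (mxdot (q 0%N) (q 0%N)) (mxdot (q k.+1) (q k.+1)) => A B.
move: (mxdot (q k.+1) (q 0%N)) (mxdot (q k.+1) r) => x y sb sab cs.
have Ea : sin a = sin (b + a) * cos b - cos (b + a) * sin b.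
  by rewrite -sinB; congr sin; ring.
move=> /(mulr_ge0 sab).
have := congr1 (fun u => x * u) Ea.
have := congr1 (fun u => (A + B) * u) (sinD b a).
have := congr1 (fun u => sin (b + a) * A * u) cs.
move: (sin (b + a)) (cos (b + a)) => S T /= h1 h2 h3 h4 h5; lra.
Qed.

End Mxdot.

(** * Splitting along the rotation axis and its orthogonal plane *)

Lemma mxdot_mull (R : realType) (l m p : nat) (M : 'M[R]_(m, l)) (A : 'M[R]_(l, p))
  (B : 'M[R]_(m, p)) : mxdot (M *m A) B = mxdot A (M^T *m B).
Proof. by rewrite /mxdot trmx_mul mulmxA. Qed.

Section UnitAxis.
Variables (R : realType) (v : 'rV[R]_3).
Hypothesis v1 : v 0 0 ^+ 2 + v 0 1%:R ^+ 2 + v 0 2%:R ^+ 2 = 1.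
Local Notation K := (crossmat v).

Lemma crossmat_cube : K *m K *m K = - K.
Proof.
by rewrite crossmat_sq // mulmxBl -mulmxA mul_crossmat mulmx0 mul1mx sub0r.
Qed.

Lemma mxtrace_outer : \tr (v^T *m v) = 1.
Proof. by rewrite /mxtrace big_ord3 !mxE !big_ord1 !mxE -!expr2. Qed.

Lemma mxtrace_rodrigues t : \tr (rodrigues K t) = 1 + 2 * cos t.
Proof.
rewrite /rodrigues !linearD /= !linearZ /= crossmat_sq // linearB /= mxtrace_outer.
by rewrite mxtrace1 /mxtrace big_ord3 !mxE /=; ring.
Qed.

(** [K] kills the axis and acts on the plane as a quarter turn, so [K *m A] has the same inner
    products as the plane component of [A]. *)
Lemma mxdot_axis_plane p (A B : 'M[R]_(3, p)) :
  mxdot A B = mxdot (v *m A) (v *m B) + mxdot (K *m A) (K *m B).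
Proof.
rewrite !mxdot_mull -mxdotDr !mulmxA -mulmxDl tr_crossmat mulNmx crossmat_sq //.
by rewrite opprB addrCA subrr addr0 mul1mx.
Qed.

Lemma mxdot_skew p (A : 'M[R]_(3, p)) : mxdot (K *m A) A = 0.
Proof.
have := mxdot_mull _ _ _ _ K A A.
rewrite tr_crossmat mulNmx -scaleN1r mxdotZr (mxdotC _ _ _ A); lra.
Qed.

(** The squared norm 3 of each [Y i] splits as 1 on the axis and 2 on the plane; the axis thus
    contributes at most [n], the plane at most [2 n cos (gamma / n)]. *)
Lemma cycle_trace_le (Y : nat -> 'M[R]_3) n gamma :
  (1 < n)%N -> - pi <= gamma <= pi -> (forall i, Y i *m (Y i)^T = 1%:M) ->
  Y n = rodrigues K gamma *m Y 0%N ->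
  \sum_(i < n) mxdot (Y i) (Y i.+1) <= n%:R * (1 + 2 * cos (gamma / n%:R)).
Proof.
move=> n1 /andP[g1 g2] YY Yn.
have n0 : 0 < n%:R :> R by rewrite ltr0n; lia.
have axis1 i : mxdot (v *m Y i) (v *m Y i) = 1.
  by rewrite mxdot_mull /mxdot mxtrace_mulC !mulmxA -!mulmxA YY mulmx1 mxtrace_outer.
have plane2 i : mxdot (K *m Y i) (K *m Y i) = 2.
  have := mxdot_axis_plane _ (Y i) (Y i); rewrite axis1 {1}/mxdot mxtrace_mulC YY mxtrace1; lra.
under eq_bigr do rewrite mxdot_axis_plane.
rewrite big_split /= mulrDr mulr1; apply: lerD.
  have axis_sum : \sum_(i < n) mxdot (v *m Y i) (v *m Y i) = n%:R.
    by under eq_bigr do rewrite axis1; rewrite big_const_ord iter_addr_0.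
  rewrite -axis_sum; apply: (@periodic_sum_dot R 1 3 (fun i => v *m Y i)).
  rewrite Yn mulmxA /rodrigues !mulmxDr -!scalemxAr !mulmxA mul_crossmat.
  by rewrite mul0mx !scaler0 !addr0 mulmx1.
have KYn : K *m Y n = cos gamma *: (K *m Y 0%N) + sin gamma *: (K *m (K *m Y 0%N)).
  rewrite Yn /rodrigues !mulmxA !mulmxDr -!scalemxAr !mulmxA crossmat_cube mulmx1.
  rewrite !mulmxDl -!scalemxAl mulNmx scalerBl scale1r scalerN opprK.
  by rewrite addrAC addrA addrN add0r.
have rr : mxdot (K *m (K *m Y 0%N)) (K *m (K *m Y 0%N)) = mxdot (K *m Y 0%N) (K *m Y 0%N).
  rewrite mxdot_mull tr_crossmat mulNmx !mulmxA crossmat_cube mulNmx opprK //.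
have := @twisted_sum_dot R 3 3 (fun i => K *m Y i) _ n (`|gamma| / n%:R) n1.
have nn : n%:R * (`|gamma| / n%:R) = `|gamma| by field; rewrite gt_eqF.
rewrite nn.
have -> : cos (`|gamma| / n%:R) = cos (gamma / n%:R).
  by case: (ger0P gamma) => // _; rewrite mulNr cosN.
have plane_sum : \sum_(i < n) mxdot (K *m Y i) (K *m Y i) = 2 *+ n.
  by under eq_bigr do rewrite plane2; rewrite big_const_ord iter_addr_0.
rewrite plane_sum => H; rewrite [leRHS](_ : _ = cos (gamma / n%:R) * (2 *+ n)); last first.
  by rewrite -[2 *+ n]mulr_natr; ring.
(* The Wirtinger bound is used at the nonnegative angle [|gamma|]; for negative [gamma] the sign
   moves to the direction [r], the quarter turn of [K *m Y 0]. *)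
apply: (H (if 0 <= gamma then K *m (K *m Y 0%N) else -1 *: (K *m (K *m Y 0%N)))).
- by rewrite divr_ge0 // ltW.
- by rewrite ler_norml g1.
- by case: ifP => _; rewrite ?mxdotZl ?mxdotZr rr //; ring.
- by case: ifP => _; rewrite ?mxdotZl mxdot_skew ?mulr0.
- rewrite KYn; case: (ger0P gamma) => // _.
  by rewrite cosN sinN scalerA mulrN1 opprK.
Qed.

End UnitAxis.

(** * The cost as a sum over the edges of the cycle *)

Lemma val_ordS n (i : 'I_n) : ordS i = (if i.+1 == n then 0 else i.+1)%N :> nat.
Proof.
rewrite /=; case: eqP => [->|/eqP ne]; first by rewrite modnn.
by rewrite modn_small // ltn_neqAle ne ltn_ord.
Qed.

(** On at least three nodes a node, its successor and its predecessor are distinct, so the nested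
    cases are exclusive and can be added. *)
Lemma Rtilde_blockE (R : realType) n (Rm : 'I_n -> 'M[R]_3) (i j : 'I_n) :
  (3 <= n)%N ->
  Rtilde_block Rm i j = (i == j)%:R *: 1%:M + (j == ordS i)%:R *: Rm i
                        + (i == ordS j)%:R *: (Rm j)^T.
Proof.
move=> hn; rewrite /Rtilde_block.
rewrite -[(j : nat) == succ_node i]/(j == ordS i) -[(i : nat) == succ_node j]/(i == ordS j).
have [->|ij] := eqVneq i j.
  have -> : (j == ordS j) = false.
    by apply/negP => /eqP jS; have := val_ordS n j; rewrite -jS; case: eqP; have := ltn_ord j; lia.
  by rewrite !scale0r scale1r !addr0.
case: eqVneq => [jS|_].
  have -> : (i == ordS j) = false.
    apply/negP => /eqP iS; have := val_ordS n j; have := val_ordS n i.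
    by rewrite -jS -iS; do 2![case: eqP]; have := ltn_ord i; have := ltn_ord j; lia.
  by rewrite !scale0r scale1r add0r addr0.
by case: eqVneq => _; rewrite !scale0r !add0r ?scale1r.
Qed.

(** Each diagonal block contributes [\tr 1 = 3], and each edge occurs in both orientations with the
    same trace. *)
Lemma costE (R : realType) n (Rm X : 'I_n -> 'M[R]_3) :
  (3 <= n)%N -> (forall i, (X i)^T *m X i = 1%:M) ->
  cost Rm X = - (n%:R * 3 + 2 * \sum_(i < n) mxdot (X i) (Rm i *m X (ordS i))).
Proof.
move=> hn XX; rewrite /cost; congr (- _).
under eq_bigr => i _ do under eq_bigr => j _ do
  rewrite Rtilde_blockE // !mulmxDr !mulmxDl !linearD /= -!scalemxAr -!scalemxAl !linearZ /=.
under eq_bigr do rewrite !big_split /=.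
rewrite !big_split /= -addrA; congr (_ + _).
  rewrite (eq_bigr (fun=> 3)) => [|i _].
    by rewrite big_const_ord iter_addr_0 mulr_natl.
  rewrite (bigD1 i) //= eqxx mul1r mulmx1 XX mxtrace1 big1 ?addr0 // => j.
  by rewrite eq_sym => /negbTE ->; rewrite mul0r.
rewrite mulrDl mul1r; congr (_ + _).
  apply: eq_bigr => i _; rewrite (bigD1 (ordS i)) //= eqxx mul1r big1.
    by rewrite addr0 /mxdot mulmxA.
  by move=> j /negbTE ->; rewrite mul0r.
rewrite exchange_big /=.
apply: eq_bigr => i _; rewrite (bigD1 (ordS i)) //= eqxx mul1r big1.
  by rewrite addr0 mxdotC /mxdot trmx_mul.
by move=> j /negbTE ->; rewrite mul0r.
Qed.

(** * Closure properties of SO(3) *)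

Section SO3Group.
Variable R : realType.
Implicit Types A B : 'M[R]_3.

Lemma SO3_1 : SO3 (1%:M : 'M[R]_3).
Proof. by split; rewrite ?trmx1 ?mul1mx ?det1. Qed.

Lemma SO3_mul A B : SO3 A -> SO3 B -> SO3 (A *m B).
Proof.
move=> [AA dA] [BB dB]; split; last by rewrite det_mulmx dA dB mulr1.
by rewrite trmx_mul mulmxA -(mulmxA _ _ A) AA mulmx1.
Qed.

Lemma SO3_tr A : SO3 A -> SO3 A^T.
Proof. by move=> [/mulmx1C AA dA]; split; rewrite ?trmxK ?det_tr. Qed.

Lemma SO3_exp A k : SO3 A -> SO3 (A ^+ k).
Proof.
move=> sA; elim: k => [|k IH]; first exact: SO3_1.
by rewrite exprS; exact: SO3_mul.
Qed.

Lemma SO3_prod k (F : nat -> 'M[R]_3) :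
  (forall i, SO3 (F i)) -> SO3 (\prod_(i < k) F i).
Proof.
move=> sF; elim: k => [|k IH]; first by rewrite big_ord0; exact: SO3_1.
by rewrite big_ord_recr; exact: SO3_mul.
Qed.

End SO3Group.

(** * Gauge transformation to identity measurements *)

Section Gauge.
Variables (R : realType) (n : nat) (Rm X : 'I_n.+1 -> 'M[R]_3).

(** Indexed by [nat] through [inord], so that [k] can reach [n.+1], where the product is the whole
    cycle error. *)
Definition partial_prod (k : nat) : 'M[R]_3 := \prod_(i < k) Rm (inord i).

(* In these gauge-transformed unknowns every edge but the last one carries the
   identity measurement; index [n.+1] stands for node [0] seen through the
   cycle error. *)
Definition gauged (k : nat) : 'M[R]_3 := partial_prod k *m X (inord (k %% n.+1)).

Lemma gauged_ord (i : 'I_n.+1) : gauged i = partial_prod i *m X i.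
Proof. by rewrite /gauged modn_small ?ltn_ord // inord_val. Qed.

Lemma gauged_last : gauged n.+1 = cycle_error Rm *m gauged 0.
Proof.
rewrite /gauged modnn mod0n /partial_prod big_ord0 mul1mx; congr (_ *m _).
by apply: eq_bigr => i _; rewrite inord_val.
Qed.

Lemma partial_prodE (i : 'I_n.+1) : \prod_(k < n.+1 | (k < i)%N) Rm k = partial_prod i.
Proof.
rewrite /partial_prod (big_ord_widen n.+1 (fun k => Rm (inord k))) 1?ltnW //.
by apply: eq_bigr => k _; rewrite inord_val.
Qed.

Hypothesis hRm : forall k, SO3 (Rm k).

Lemma SO3_partial_prod k : SO3 (partial_prod k).
Proof. exact: (SO3_prod _ _ (fun i => Rm (inord i))). Qed.

(** Both arguments share the left factor [partial_prod i], which is orthogonal and cancels; on the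
    closing edge [ordS] wraps around as the modulus in [gauged] does. *)
Lemma mxdot_gauged (i : 'I_n.+1) :
  mxdot (gauged i) (gauged i.+1) = mxdot (X i) (Rm i *m X (ordS i)).
Proof.
rewrite gauged_ord /gauged /partial_prod big_ord_recr /= inord_val.
have -> : inord (i.+1 %% n.+1) = ordS i.
  by apply/val_inj; rewrite /= inordK // ltn_mod.
have [PP _] := SO3_partial_prod i.
rewrite -/(partial_prod i) /mxdot trmx_mul -!mulmxE !mulmxA.
by rewrite -(mulmxA _ _ (partial_prod i)) PP mulmx1.
Qed.

Lemma cost_gauged : (3 <= n.+1)%N -> (forall i, SO3 (X i)) ->
  cost Rm X = - (n.+1%:R * 3 + 2 * \sum_(i < n.+1) mxdot (gauged i) (gauged i.+1)).
Proof.
move=> hn hX; rewrite costE //; last by move=> i; case: (hX i).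
by under [in RHS]eq_bigr do rewrite mxdot_gauged.
Qed.

End Gauge.

(** * Optimality of the candidate *)

Theorem theorem2 (R : realType) (n : nat) (hn : (3 <= n)%N)
  (Rm : 'I_n -> 'M[R]_3) (hRm : forall k, SO3 (Rm k))
  (nhat : 'rV[R]_3) (gamma : R)
  (hnhat : nhat 0 0 ^+ 2 + nhat 0 1%:R ^+ 2 + nhat 0 2%:R ^+ 2 = 1)
  (hgamma : - pi <= gamma <= pi)
  (hE : cycle_error Rm = expm (gamma *: crossmat nhat)) :
  let E0 := expm ((gamma / n%:R) *: crossmat nhat) in
  (forall i, SO3 (Rstar Rm E0 i)) /\
  (forall X : 'I_n -> 'M[R]_3, (forall i, SO3 (X i)) ->
     cost Rm (Rstar Rm E0) <= cost Rm X).
Proof.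
case: n hn Rm hRm hE => // n hn Rm hRm.
have K3 := crossmat_cube R nhat hnhat; have KT := tr_crossmat R nhat.
rewrite !expm_rodrigues // => hE /=.
set K := crossmat nhat in K3 KT hE *; set a := gamma / _.
have SE0 : SO3 (rodrigues K a) by exact: SO3_rodrigues.
have starE i : Rstar Rm (rodrigues K a) i = (partial_prod R n Rm i)^T *m rodrigues K a ^+ i.
  by rewrite /Rstar partial_prodE.
have SP := SO3_partial_prod R n Rm hRm.
have SRstar i : SO3 (Rstar Rm (rodrigues K a) i).
  by rewrite starE; apply: SO3_mul; [exact: SO3_tr | exact: SO3_exp].
split=> // X hX; rewrite !cost_gauged // lerN2 lerD2l ler_pM2l //.
set Y := gauged _ _ _ (Rstar _ _).
have Yord (i : 'I_n.+1) : Y i = rodrigues K a ^+ i.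
  by rewrite /Y gauged_ord starE mulmxA (mulmx1C (SP i).1) mul1mx.
have YE k : (k <= n.+1)%N -> Y k = rodrigues K (a *+ k).
  rewrite leq_eqVlt ltnS => /orP[/eqP ->|kn].
    (* At the closing index the value comes from the cycle error instead, and agrees because [n.+1]
       steps of angle [a] make up [gamma]. *)
    rewrite /Y gauged_last -/Y hE (Yord ord0) expr0 mulmx1; congr rodrigues.
    by rewrite /a -[RHS]mulr_natr divfK // pnatr_eq0.
  by rewrite (Yord (Ordinal (kn : (k < n.+1)%N))) rodriguesX.
have Ydot (i : 'I_n.+1) : mxdot (Y i) (Y i.+1) = 1 + 2 * cos a.
  rewrite !YE ?ltn_ord //; last exact: ltnW.
  rewrite /mxdot tr_rodrigues // rodriguesD // mulrS addrCA addNr addr0.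
  by rewrite mxtrace_rodrigues.
(* The candidate's edge sum is exactly the upper bound of [cycle_trace_le], which is now applied to
   the competitor [X]. *)
rewrite [leRHS](eq_bigr _ (fun i _ => Ydot i)) big_const_ord iter_addr_0.
rewrite -[leRHS]mulr_natl; apply: (cycle_trace_le R nhat hnhat (gauged R n Rm X)) => //.
- exact: ltnW.
- by move=> i; apply/mulmx1C; apply: (SO3_mul _ _ _ (SP i) (hX _)).1.
- by rewrite gauged_last hE.
Qed.
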